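(* Let $G,H$ be finite simple connected graphs, fix a root $(r_G,r_H)\in V(G\,\square\,H)$, let $K\in\{G,H\}$ with $\bar K$ the other graph, and let $(S,T)$ be an ordered pair of disjoint subsets of $V(\bar K)$ such that $i\sim_{\bar K} j$ for all $i\in S$, $j\in T$. Put $M=2\pi(G)\pi(H)$. Then every configuration $c$ on $G\,\square\,H$ from which no sequence of pebbling moves places a pebble on $(r_G,r_H)$ satisfies \[ \sum_{i\in S}pair_{K,i}+1\ \le\ \sum_{j\in T}\bigl(\pi(K)-extra_{K,j}\bigr)+M\Bigl(|S|-\sum_{i\in S}x_{K,i,1}\Bigr)+M\bigl(1-y_{K,\pi(\bar K)-|T|}\bigr). \]
   Context: The Cartesian product $G\,\square\,H$ has vertex set $V(G)\times V(H)$, with $(g,h)\sim(g',h')$ iff ($g=g'$ and $h\sim_H h'$) or ($h=h'$ and $g\sim_G g'$). $|X|$ is the number of vertices of $X$. A configuration is a function $c:V(G\,\square\,H)\to\mathbb{Z}_{\ge0}$. A pebbling move removes two pebbles from a vertex and adds one to an adjacent vertex. $\pi(X)$ (pebbling number) is the least $k$ such that from every configuration of size $k$ on $X$ and every root some sequence of pebbling moves places a pebble on the root. For $K\in\{G,H\}$, $\bar K$ is the other graph; for $j\in V(\bar K)$ the $K$-slice $K_j$ is $\{(i,j):i\in V(G)\}$ if $K=G$ and $\{(j,h):h\in V(H)\}$ if $K=H$. For a configuration $c$: $\tilde c_{K,j}=\sum_{u\in K_j}c(u)$; $set_{K,j}=\lfloor\tilde c_{K,j}/\pi(K)\rfloor$;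 $extra_{K,j}=\tilde c_{K,j}-\pi(K)\,set_{K,j}$; $pair_{K,j}=\lfloor extra_{K,j}/2\rfloor$; $sat_{K,j}=\lfloor(\tilde c_{K,j}-extra_{K,j})/|K|\rfloor$; $x_{K,j,t}=1$ if $sat_{K,j}\ge t$ and $0$ otherwise; $y_{K,s}=1$ if $\sum_{j\in V(\bar K)}set_{K,j}\ge s$ and $0$ otherwise. *)

(* Defs.v *)
From mathcomp Require Import all_boot all_order all_algebra.
From mathcomp Require Import boolp.

Set Implicit Arguments.
Unset Strict Implicit.
Unset Printing Implicit Defensive.

Record sgraph := SGraph {
  vertex :> finType;
  adj : rel vertex;
  adj_sym : symmetric adj;
  adj_irrefl : irreflexive adj }.

(* The empty graph satisfies this predicate. *)
Definition graph_connected (X : sgraph) : Prop :=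
  forall u v : X, connect (@adj X) u v.

Section CartesianProduct.
Variables G H : sgraph.

Definition cprod_adj : rel (G * H)%type := fun p q =>
  ((p.1 == q.1) && adj p.2 q.2) || ((p.2 == q.2) && adj p.1 q.1).

Lemma cprod_adj_sym : symmetric cprod_adj.
Proof.
by move=> p q; rewrite /cprod_adj ![q.1 == _]eq_sym ![q.2 == _]eq_sym
  (adj_sym q.1) (adj_sym q.2).
Qed.

Lemma cprod_adj_irrefl : irreflexive cprod_adj.
Proof. by move=> p; rewrite /cprod_adj !adj_irrefl !andbF. Qed.

Definition cprod : sgraph := SGraph cprod_adj_sym cprod_adj_irrefl.

End CartesianProduct.

Section Pebbling.
Variable X : sgraph.

Definition config := {ffun X -> nat}.

Definition config_size (c : config) : nat := \sum_(v : X) c v.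

Definition pebbling_move (c : config) (u v : X) : config :=
  [ffun w => if w == u then c w - 2 else if w == v then c w + 1 else c w].

Inductive reachable : config -> config -> Prop :=
| reachable_refl (c : config) : reachable c c
| reachable_step (c : config) (u v : X) (c' : config) :
    adj u v -> 2 <= c u -> reachable (pebbling_move c u v) c' -> reachable c c'.

Definition pebble_solvable (c : config) (r : X) : Prop :=
  exists2 c', reachable c c' & 0 < c' r.

Definition always_solvable (k : nat) : Prop :=
  forall (c : config) (r : X), config_size c = k -> pebble_solvable c r.

(* The value 0 in the second case is never used for connected graphs, see
   pebbling_numberP. *)
Definition pebbling_number : nat :=
  if pselect (exists k, `[< always_solvable k >]) is left ex_k
  then ex_minn ex_k else 0.

Lemma reachable_trans c1 c2 c3 :
  reachable c1 c2 -> reachable c2 c3 -> reachable c1 c3.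
Proof.
move=> r12; elim: r12 c3 => // c u v c' uv cu _ IH c3 /IH.
exact: reachable_step.
Qed.

Lemma reachable_carry (c : config) (u v : X) m :
  adj u v -> 2 * m <= c u -> exists2 c', reachable c c' & c v + m <= c' v.
Proof.
move=> uv; elim: m c => [|m IH] c cu.
  by exists c; [exact: reachable_refl | rewrite addn0].
have vu : (v == u) = false.
  by apply/eqP => vu; move: uv; rewrite vu adj_irrefl.
rewrite mulnS in cu; have cu2 : 2 <= c u := leq_trans (leq_addr _ _) cu.
have [|c' rc' cv] := IH (pebbling_move c u v).
  by rewrite ffunE eqxx leq_subRL.
exists c'; first exact: reachable_step rc'.
by move: cv; rewrite ffunE vu eqxx -addnA add1n.
Qed.

Lemma solvable_path (c : config) (u : X) p :
  path (@adj X) u p -> 2 ^ size p <= c u -> pebble_solvable c (last u p).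
Proof.
elim: p u c => [|v p IH] u c /=.
  by move=> _ cu; exists c; first exact: reachable_refl.
case/andP=> uv vp; rewrite expnS => cu.
have [c' rc c'v] := reachable_carry uv cu.
have [|c2 r2 h2] := IH v c' vp; first exact: leq_trans (leq_addl _ _) c'v.
by exists c2 => //; exact: reachable_trans rc r2.
Qed.

Lemma always_solvable_ex :
  graph_connected X -> exists k, always_solvable k.
Proof.
move=> conX; exists (#|X| * 2 ^ #|X|) => c r size_c.
case: (boolP [exists u, 2 ^ #|X| <= c u]) => [/existsP[u cu]|/existsPn small].
  have /connectP[p up ->] := conX u r.
  have [q uq uniq_q _] := shortenP up.
  apply: solvable_path => //; apply: leq_trans cu.
  rewrite leq_exp2l //; have := max_card (mem (u :: q)).
  by rewrite (card_uniqP uniq_q); apply: ltnW.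
suff: config_size c < #|X| * 2 ^ #|X| by rewrite size_c ltnn.
rewrite /config_size -sum_nat_const (bigD1 r) //= [ltnRHS](bigD1 r) //=.
rewrite -addSn leq_add //; first by rewrite ltnNge.
by apply: leq_sum => u _; rewrite ltnW // ltnNge.
Qed.

Lemma pebbling_numberP : graph_connected X ->
  always_solvable pebbling_number /\
  forall k, always_solvable k -> pebbling_number <= k.
Proof.
move=> conX; rewrite /pebbling_number; case: pselect => [ex_k|[]]; last first.
  by have [k kP] := always_solvable_ex conX; exists k; apply/asboolP.
case: ex_minnP => m /asboolP mP m_min; split=> // k kP.
by apply: m_min; apply/asboolP.
Qed.

End Pebbling.

(* The choice of K in {G, H}. *)
Inductive side := SideG | SideH.

Section Slices.
Variables (G H : sgraph) (K : side).

Definition graphK : sgraph := if K is SideG then G else H.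
Definition graphKbar : sgraph := if K is SideG then H else G.

Definition slice : graphKbar -> {set cprod G H} :=
  match K return (if K is SideG then H else G) -> {set cprod G H} with
  | SideG => fun j => [set ((i, j) : cprod G H) | i : G]
  | SideH => fun j => [set ((j, h) : cprod G H) | h : H]
  end.

Variable c : config (cprod G H).

Definition slice_size (j : graphKbar) : nat := \sum_(u in slice j) c u.

Definition slice_set (j : graphKbar) : nat :=
  slice_size j %/ pebbling_number graphK.

(* The natural-number subtractions in slice_extra and slice_sat are never
   truncated. *)
Definition slice_extra (j : graphKbar) : nat :=
  slice_size j - pebbling_number graphK * slice_set j.

Definition slice_pair (j : graphKbar) : nat := slice_extra j %/ 2.

Definition slice_sat (j : graphKbar) : nat :=
  (slice_size j - slice_extra j) %/ #|graphK|.

Definition x_ind (j : graphKbar) (t : nat) : nat :=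
  if t <= slice_sat j then 1 else 0.

Definition y_ind (s : int) : nat :=
  if (s <= (\sum_(j : graphKbar) slice_set j)%N%:Z)%R then 1 else 0.

End Slices.

(* Main.v *)
Require Import Defs.
From mathcomp Require Import all_boot all_order all_algebra.
From mathcomp Require Import zify.

Set Implicit Arguments.
Unset Strict Implicit.
Unset Printing Implicit Defensive.

Import GRing.Theory.

(* Configurations form a commutative monoid, reachability is compatible with
    addition, and a graph homomorphism carries reachable configurations to
    reachable ones.  Hence the slices of a product can be played independently:
    each set of pi(K) pebbles in a slice brings a pebble to the copy of the root
    of K, and pi(Kbar) sets suffice to solve the root.

    In the inequality the terms with [M] dominate unless every slice in [S] is
    saturated and there are at least pi(Kbar) - |T| sets.  In that case suppose
    that the pairs of the slices in [S] are at least as many as the pebbles that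
    the slices in [T] lack to complete one more set each.  By saturation and the
    pigeonhole principle, [pair_{K,i}] moves can leave the slice [i], and the
    sets of that slice survive.  Sending these moves to [T] produces pi(Kbar)
    sets, so the root could have been reached. *)

Section Configurations.
Variable X : sgraph.
Implicit Types (c d e : config X) (u v r : X).

Lemma config_addE c d v : (c + d)%R v = c v + d v.
Proof. by rewrite ffunE. Qed.

Lemma config_sumE (I : finType) (F : I -> config X) v :
  (\sum_i F i)%R v = \sum_i F i v.
Proof. by rewrite sum_ffunE. Qed.

Lemma config_sizeD c d : config_size (c + d)%R = config_size c + config_size d.
Proof. by rewrite -big_split; apply: eq_bigr => v _; rewrite config_addE. Qed.

Lemma config_split_leq c d : (forall v, d v <= c v) -> exists e, c = (d + e)%R.
Proof.
move=> dc; exists [ffun v => c v - d v]; apply/ffunP => v.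
by rewrite config_addE ffunE subnKC.
Qed.

Definition pebble u : config X := [ffun v => (v == u) : nat].

Lemma config_size_pebble u : config_size (pebble u) = 1.
Proof.
rewrite /config_size (bigD1 u) //= ffunE eqxx big1 // => v /negbTE vu.
by rewrite ffunE vu.
Qed.

Lemma config_split_pebble c u : 0 < c u -> exists d, c = (d + pebble u)%R.
Proof.
move=> cu; have [v|d ->] := @config_split_leq c (pebble u).
  by rewrite ffunE; case: eqVneq => // ->.
by exists d; rewrite addrC.
Qed.

Lemma config_split_pair c u : 1 < c u -> exists d, c = (d + pebble u *+ 2)%R.
Proof.
move=> cu; have [d cE] := config_split_pebble (ltnW cu).
move: cu; rewrite cE config_addE ffunE eqxx addn1 => /config_split_pebble[e ->].
by exists e; rewrite mulr2n addrA.
Qed.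

Lemma config_split_size c k : k <= config_size c ->
  exists2 d, config_size d = k & exists e, c = (d + e)%R.
Proof.
elim: k => [|k IH] kc.
  exists 0%R; last by exists c; rewrite add0r.
  by rewrite /config_size big1 // => v _; rewrite ffunE.
have [d dk [e cE]] := IH (ltnW kc).
have [v ev] : exists v, 0 < e v.
  apply/existsP; apply: contraLR kc => /existsPn e0.
  rewrite cE config_sizeD dk [config_size e]big1 ?addn0 ?ltnn // => v _.
  by apply/eqP; rewrite -leqn0 leqNgt e0.
have [e' eE] := config_split_pebble ev.
exists (d + pebble v)%R.
  by rewrite config_sizeD config_size_pebble dk addn1.
by exists e'; rewrite cE eE -addrA [(e' + _)%R]addrC.
Qed.

Lemma pebbling_move_pair c u v : adj u v ->
  pebbling_move (c + pebble u *+ 2)%R u v = (c + pebble v)%R.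
Proof.
move=> uv; apply/ffunP => w; rewrite mulr2n !ffunE /=.
have neuv : u != v by apply: contraTneq uv => ->; rewrite adj_irrefl.
have [-> | _] := eqVneq w u; first by rewrite (negbTE neuv) addnK addr0.
by case: (w == v); rewrite !addr0.
Qed.

Lemma reachable_move c u v :
  adj u v -> reachable (c + pebble u *+ 2)%R (c + pebble v)%R.
Proof.
move=> uv; apply: (reachable_step uv); last first.
  by rewrite pebbling_move_pair //; exact: reachable_refl.
by rewrite config_addE mulr2n config_addE ffunE eqxx addnC.
Qed.

Lemma reachable_pebble_ind (P : config X -> config X -> Prop) :
    (forall c, P c c) ->
    (forall c u v c',
      adj u v -> P (c + pebble v)%R c' -> P (c + pebble u *+ 2)%R c') ->
  forall c c', reachable c c' -> P c c'.
Proof.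
move=> Prefl Pmove c c'; elim=> // {c c'} c u v c' uv cu _.
have [d ->] := config_split_pair cu; rewrite pebbling_move_pair //.
exact: Pmove.
Qed.

Lemma reachableDr d c c' : reachable c c' -> reachable (c + d)%R (c' + d)%R.
Proof.
elim/reachable_pebble_ind => {c c'} [c|c u v c' uv].
  exact: reachable_refl.
apply: reachable_trans; rewrite addrAC [(_ + _ + d)%R]addrAC.
exact: reachable_move.
Qed.

Lemma reachableD c c' d d' :
  reachable c c' -> reachable d d' -> reachable (c + d)%R (c' + d')%R.
Proof.
move=> rc rd; apply: reachable_trans (reachableDr d rc) _.
by rewrite ![(c' + _)%R]addrC; apply: reachableDr.
Qed.

Lemma reachable_sum (I : finType) (F F' : I -> config X) :
    (forall i, reachable (F i) (F' i)) ->
  reachable (\sum_i F i)%R (\sum_i F' i)%R.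
Proof.
move=> rF; elim/big_ind2: _ => // [|c c' d d']; first exact: reachable_refl.
exact: reachableD.
Qed.

Lemma reachable_le1_eq c c' : (forall v, c v <= 1) -> reachable c c' -> c' = c.
Proof.
move=> c1 rc; case: rc c1 => // d u v d' _ du _ d1.
by have := leq_trans du (d1 u).
Qed.

Definition fold_solvable (t : nat) c r : Prop :=
  exists2 c', reachable c c' & t <= c' r.

Lemma fold_solvable_reachable t c c' r :
  reachable c c' -> fold_solvable t c' r -> fold_solvable t c r.
Proof. by move=> rc [d rd tdr]; exists d => //; apply: reachable_trans rd. Qed.

Lemma fold_solvable_id c r : fold_solvable (c r) c r.
Proof. by exists c => //; exact: reachable_refl. Qed.

Lemma fold_solvableW s t c r :
  s <= t -> fold_solvable t c r -> fold_solvable s c r.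
Proof. by move=> st [d rd tdr]; exists d => //; apply: leq_trans tdr. Qed.

Lemma fold_solvableD s t c d r :
    fold_solvable s c r -> fold_solvable t d r ->
  fold_solvable (s + t) (c + d)%R r.
Proof.
move=> [c' rc sc] [d' rd td]; exists (c' + d')%R; first exact: reachableD.
by rewrite config_addE leq_add.
Qed.

Lemma fold_solvable_le t c d r :
  (forall v, c v <= d v) -> fold_solvable t c r -> fold_solvable t d r.
Proof.
move=> /config_split_leq[e ->] /fold_solvableD/(_ (fold_solvable_id e r)).
exact: fold_solvableW (leq_addr _ _).
Qed.

Lemma always_solvable_fold k t c r :
  always_solvable X k -> t * k <= config_size c -> fold_solvable t c r.
Proof.
move=> solk; elim: t c => [|t IH] c tk.
  exact: fold_solvableW (leq0n _) (fold_solvable_id c r).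
have [d dk [e cE]] := config_split_size (leq_trans (leq_addr _ _) tk).
rewrite cE -add1n; apply: fold_solvableD (solk d r dk) (IH e _).
by move: tk; rewrite cE config_sizeD dk mulSn leq_add2l.
Qed.

(* One pebble on every vertex but the root allows no move at all. *)
Lemma leq_card_always_solvable k r : always_solvable X k -> #|X| <= k.
Proof.
move=> solk; rewrite leqNgt; apply/negP => kX.
pose c : config X := [ffun v => (v != r) : nat].
have size_c : config_size c = #|X|.-1.
  rewrite -(cardC1 r) -sum1_card big_mkcond; apply: eq_bigr => v _.
  by rewrite ffunE inE; case: (v != r).
have [|c' rc c'r] := @always_solvable_fold k 1 c r solk.
  by rewrite size_c mul1n; lia.
move: c'r; rewrite (reachable_le1_eq _ rc) ?ffunE ?eqxx // => v.
by rewrite ffunE leq_b1.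
Qed.

Lemma leq_card_pebbling_number r :
  graph_connected X -> #|X| <= pebbling_number X.
Proof. by move=> /pebbling_numberP[/(leq_card_always_solvable r)]. Qed.

Lemma pebbling_number_gt0 r : graph_connected X -> 0 < pebbling_number X.
Proof.
move=> /(leq_card_pebbling_number r); apply: leq_trans.
by apply/card_gt0P; exists r.
Qed.

End Configurations.

Section Pushforward.
Variables (A X : sgraph) (f : A -> X).
Implicit Types c d : config A.

Definition pushforward c : config X := [ffun x => \sum_(a | f a == x) c a].

Lemma pushforwardD c d :
  pushforward (c + d)%R = (pushforward c + pushforward d)%R.
Proof.
apply/ffunP => x; rewrite config_addE !ffunE -big_split.
by apply: eq_bigr => a _; rewrite config_addE.
Qed.

Lemma pushforward_pebble a : pushforward (pebble a) = pebble (f a).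
Proof.
apply/ffunP => x; rewrite !ffunE big_mkcond (bigD1 a) //= ffunE eqxx eq_sym.
rewrite big1 => [|b /negbTE ba]; first by case: (x == _).
by rewrite ffunE ba if_same.
Qed.

Lemma leq_pushforward c a : c a <= pushforward c (f a).
Proof. by rewrite ffunE (bigD1 a) //= leq_addr. Qed.

Lemma pushforward_leq c (d : config X) x :
  injective f -> (forall a, c a <= d (f a)) -> pushforward c x <= d x.
Proof.
move=> injf cd; rewrite ffunE.
have [/codomP[a ->]|xf] := boolP (x \in codom f).
  by rewrite (eq_bigl (pred1 a)) ?big_pred1_eq // => b; rewrite (inj_eq injf).
by rewrite big_pred0 // => a; apply: contraNF xf => /eqP <-; exact: codom_f.
Qed.

Hypothesis homf : {homo f : a b / adj a b}.

Lemma reachable_pushforward c c' :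
  reachable c c' -> reachable (pushforward c) (pushforward c').
Proof.
elim/reachable_pebble_ind => {c c'} [c|c u v c' uv].
  exact: reachable_refl.
apply: reachable_trans.
rewrite mulr2n !pushforwardD !pushforward_pebble -mulr2n.
exact/reachable_move/homf.
Qed.

Lemma fold_solvable_pushforward t c r :
  fold_solvable t c r -> fold_solvable t (pushforward c) (f r).
Proof.
move=> [c' rc tr]; exists (pushforward c'); first exact: reachable_pushforward.
exact: leq_trans tr (leq_pushforward _ _).
Qed.

End Pushforward.

Section MultiplicitySequence.
Variables (I : finType) (D : {set I}) (m : I -> nat).

Definition mult_seq : seq I := flatten [seq nseq (m i) i | i in D].

Lemma count_mem_mult_seq i : count_mem i mult_seq = (i \in D) * m i.
Proof.
rewrite /mult_seq count_flatten -map_comp sumnE big_map big_enum /=.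
under eq_bigr do rewrite count_nseq.
rewrite big_mkcond (bigD1 i) //= eqxx mul1n big1 => [|j /negbTE ji].
  by case: (i \in D); rewrite !(addn0, mul1n).
by rewrite ji if_same.
Qed.

Lemma size_mult_seq : size mult_seq = \sum_(i in D) m i.
Proof.
rewrite /mult_seq size_flatten /shape -map_comp sumnE big_map big_enum /=.
by apply: eq_bigr => i _; rewrite size_nseq.
Qed.

Lemma mem_mult_seq : {subset mult_seq <= D}.
Proof.
move=> i; rewrite -has_pred1 has_count count_mem_mult_seq.
by case: (i \in D).
Qed.

End MultiplicitySequence.

Lemma Posz_sum (I : Type) (s : seq I) (P : pred I) (F : I -> nat) :
  Posz (\sum_(i <- s | P i) F i) = (\sum_(i <- s | P i) Posz (F i))%R.
Proof. exact: (big_morph Posz PoszD (erefl _)). Qed.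

Section Slices.
Variables (G H : sgraph) (K : side).
Local Notation A := (graphK G H K).
Local Notation B := (graphKbar G H K).
Local Notation piA := (pebbling_number A).
Local Notation piB := (pebbling_number B).
Implicit Types (c d : config (cprod G H)) (S T : {set B}) (a : A) (b : B).

Definition slice_vertex : A -> B -> cprod G H :=
  match K return (if K is SideG then G else H) ->
    (if K is SideG then H else G) -> cprod G H with
  | SideG => fun g h => (g, h)
  | SideH => fun h g => (g, h)
  end.

Lemma slice_vertex_eq a a' b b' :
  (slice_vertex a b == slice_vertex a' b') = (a == a') && (b == b').
Proof.
rewrite /slice_vertex; case: K a a' b b' => a a' b b'; rewrite xpair_eqE //.
exact: andbC.
Qed.

Lemma slice_vertexP x : exists a b, x = slice_vertex a b.
Proof.
by rewrite /slice_vertex; case: x K => g h [|]; [exists g, h | exists h, g].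
Qed.

Lemma homo_slice_vertexl b : {homo slice_vertex^~ b : a a' / adj a a'}.
Proof.
by rewrite /slice_vertex; case: K b => b a a' aa';
  rewrite /= /cprod_adj /= eqxx aa' ?orbT.
Qed.

Lemma homo_slice_vertexr a : {homo slice_vertex a : b b' / adj b b'}.
Proof.
by rewrite /slice_vertex; case: K a => a b b' bb';
  rewrite /= /cprod_adj /= eqxx bb' ?orbT.
Qed.

Lemma slice_sizeE c b : slice_size c b = \sum_a c (slice_vertex a b).
Proof.
rewrite /slice_size /slice /slice_vertex.
by case: K b => b; rewrite big_imset //= => a a' _ _ [].
Qed.

Lemma slice_sizeD c d b :
  slice_size (c + d)%R b = slice_size c b + slice_size d b.
Proof. by rewrite -big_split; apply: eq_bigr => v _; rewrite config_addE. Qed.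

Lemma slice_size_pebble a b b' :
  slice_size (pebble (slice_vertex a b)) b' = (b' == b).
Proof.
rewrite slice_sizeE (bigD1 a) //= ffunE slice_vertex_eq eqxx.
rewrite big1 ?addn0 // => a' /negbTE a'a.
by rewrite ffunE slice_vertex_eq a'a.
Qed.

Definition slice_config c b : config A := [ffun a => c (slice_vertex a b)].

Lemma config_size_slice_config c b :
  config_size (slice_config c b) = slice_size c b.
Proof. by rewrite slice_sizeE; apply: eq_bigr => a _; rewrite ffunE. Qed.

Lemma sum_pushforward_slice_config c :
  (\sum_b pushforward (slice_vertex^~ b) (slice_config c b))%R = c.
Proof.
apply/ffunP => x; have [a [b ->]] := slice_vertexP x.
rewrite config_sumE (bigD1 b) //= [X in _ + X]big1 => [|b' /negbTE b'b].
  rewrite addn0 ffunE (big_pred1 a) ?ffunE // => a'.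
  by rewrite slice_vertex_eq eqxx andbT.
by rewrite ffunE big_pred0 // => a'; rewrite slice_vertex_eq b'b andbF.
Qed.

Lemma slice_pigeonhole c b :
  #|A| < slice_size c b -> exists a, 1 < c (slice_vertex a b).
Proof.
move=> Ac; apply/existsP; apply: contraLR Ac => /existsPn small.
rewrite -leqNgt slice_sizeE -sum1_card; apply: leq_sum => a _.
by rewrite leqNgt small.
Qed.

(* The [k]-th move goes from the slice [nth _ s k] to the slice [nth _ t k]. *)
Lemma reachable_slice_moves (s t : seq B) c : size s = size t ->
    {in s & t, forall i j, adj i j} ->
    {in s, forall i : B, #|A| + 2 * count_mem i s <= slice_size c i} ->
  exists2 c', reachable c c' & forall b : B,
    slice_size c' b + 2 * count_mem b s = slice_size c b + count_mem b t.
Proof.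
move=> st; move: s t st c; apply: seq_ind2 => [|i j s t _ IH] c adj_st big_s.
  by exists c => //; exact: reachable_refl.
have [a ca] : exists a, 1 < c (slice_vertex a i).
  apply: slice_pigeonhole; have := big_s i (mem_head _ _).
  by rewrite /= eqxx; lia.
have [d cE] := config_split_pair ca.
have size_c b : slice_size c b = slice_size d b + 2 * (i == b).
  by rewrite cE mulr2n !slice_sizeD !slice_size_pebble eq_sym; lia.
pose c1 := (d + pebble (slice_vertex a j))%R.
have size_c1 b : slice_size c1 b = slice_size d b + (j == b).
  by rewrite slice_sizeD slice_size_pebble eq_sym.
have [i' j' i's j't|i' i's|c' rc' c'E] := IH c1.
- by apply: adj_st; rewrite inE ?i's ?j't orbT.
- have := big_s i'; rewrite inE i's orbT => /(_ isT) /=.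
  by rewrite size_c size_c1; lia.
exists c' => [|b]; last by have := c'E b; rewrite /= size_c size_c1; lia.
apply: reachable_trans rc'; rewrite cE; apply/reachable_move/homo_slice_vertexr.
by apply: adj_st; rewrite mem_head.
Qed.

Lemma slice_extraE c b : slice_extra c b = slice_size c b %% piA.
Proof.
rewrite /slice_extra /slice_set mulnC.
by rewrite {1}(divn_eq (slice_size c b) piA) addKn.
Qed.

Lemma slice_size_set_extra c b :
  slice_size c b = slice_set c b * piA + slice_extra c b.
Proof. by rewrite slice_extraE -divn_eq. Qed.

Lemma slice_pair_leq c b : 2 * slice_pair c b <= slice_extra c b.
Proof. by rewrite mulnC leq_divM. Qed.

Definition slice_deficit c b : nat := piA - slice_extra c b.

Lemma slice_sat_gt0_leq_card c b :
  0 < slice_sat c b -> #|A| <= slice_set c b * piA.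
Proof.
rewrite /slice_sat slice_size_set_extra addnK.
by case: (posnP #|A|) => [->|A0]; rewrite ?divn0 // divn_gt0.
Qed.

Section Connected.
Hypotheses (conA : graph_connected A) (conB : graph_connected B).
Variables (rA : A) (rB : B).

Lemma slice_extra_lt c b : slice_extra c b < piA.
Proof. by rewrite slice_extraE ltn_pmod ?(pebbling_number_gt0 rA). Qed.

Lemma fold_solvable_slice_set c b :
  fold_solvable (slice_set c b)
    (pushforward (slice_vertex^~ b) (slice_config c b)) (slice_vertex rA b).
Proof.
apply: fold_solvable_pushforward; first exact: homo_slice_vertexl.
apply: always_solvable_fold (pebbling_numberP conA).1 _.
by rewrite config_size_slice_config leq_divM.
Qed.

Lemma solvable_sum_slice_set c :
  piB <= \sum_(b : B) slice_set c b -> pebble_solvable c (slice_vertex rA rB).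
Proof.
move=> sets; pose d : config B := [ffun b => slice_set c b].
have [c' rc' c'r] := fin_all_exists2 (fold_solvable_slice_set c).
have rc : reachable c (\sum_b c' b)%R.
  by rewrite -{1}[c]sum_pushforward_slice_config; exact: reachable_sum.
apply: (@fold_solvable_reachable _ 1) rc _.
have sol_d : fold_solvable 1 d rB.
  apply: always_solvable_fold (pebbling_numberP conB).1 _.
  by rewrite mul1n (leq_trans sets) //; apply: leq_sum => b _; rewrite ffunE.
have := fold_solvable_pushforward (@homo_slice_vertexr rA) sol_d.
apply: fold_solvable_le => x; apply: pushforward_leq => [b b' /eqP|b].
  by rewrite slice_vertex_eq eqxx => /eqP.
rewrite config_sumE ffunE (bigD1 b) //=.
exact: leq_trans (c'r b) (leq_addr _ _).
Qed.

Lemma reachable_complete_sets S T c :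
    [disjoint S & T] -> (forall i j, i \in S -> j \in T -> adj i j) ->
    {in S, forall i : B, 0 < slice_sat c i} ->
    \sum_(j in T) slice_deficit c j <= \sum_(i in S) slice_pair c i ->
  exists2 c', reachable c c' &
    forall b : B, slice_set c b + (b \in T) <= slice_set c' b.
Proof.
move=> disST adjST satS enough_pairs.
pose t := mult_seq T (slice_deficit c).
pose s := take (size t) (mult_seq S (slice_pair c)).
have size_s : size s = size t by rewrite size_takel // !size_mult_seq.
have count_s i : count_mem i s <= (i \in S) * slice_pair c i.
  by rewrite -count_mem_mult_seq leq_count_subseq ?take_subseq.
have [i j /mem_take/mem_mult_seq iS /mem_mult_seq|i|c' rc c'E] :=
    @reachable_slice_moves s t c size_s.
- exact: adjST.
- move=> /mem_take/mem_mult_seq iS; have := slice_sat_gt0_leq_card (satS i iS).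
  have := count_s i; have := slice_pair_leq c i.
  by rewrite slice_size_set_extra iS; lia.
exists c' => // b; rewrite leq_divRL ?(pebbling_number_gt0 rA) //.
have := c'E b.
rewrite (slice_size_set_extra c) count_mem_mult_seq /slice_deficit.
have := count_s b; have := slice_pair_leq c b; have := slice_extra_lt c b.
have [bT|_] := boolP (b \in T); last by case: (b \in S); lia.
by rewrite (disjointFl disST bT); lia.
Qed.

Lemma unsolvable_sum_slice_pair_lt S T c :
    [disjoint S & T] -> (forall i j, i \in S -> j \in T -> adj i j) ->
    ~ pebble_solvable c (slice_vertex rA rB) ->
    {in S, forall i : B, 0 < slice_sat c i} ->
    piB <= \sum_(b : B) slice_set c b + #|T| ->
  \sum_(i in S) slice_pair c i < \sum_(j in T) slice_deficit c j.
Proof.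
move=> disST adjST unsol satS sets; rewrite ltnNge; apply/negP.
move=> /(reachable_complete_sets disST adjST satS)[c' rc more_sets].
apply/unsol/(@fold_solvable_reachable _ 1 c c') => //.
apply/solvable_sum_slice_set/(leq_trans sets).
rewrite -sum1_card [X in _ + X]big_mkcond -big_split; apply: leq_sum => b _ /=.
by have := more_sets b; case: (b \in T).
Qed.

Lemma sum_slice_pair_lt S c : \sum_(i in S) slice_pair c i < 2 * (piA * piB).
Proof.
have piA0 := pebbling_number_gt0 rA conA.
have piB0 := pebbling_number_gt0 rB conB.
apply: (@leq_ltn_trans (piA * piB)); last by rewrite ltn_Pmull // muln_gt0 piA0.
apply: (@leq_trans (\sum_(i in S) piA)).
  apply: leq_sum => i _; have := slice_pair_leq c i.
  by have := slice_extra_lt c i; lia.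
rewrite sum_nat_const mulnC leq_mul2l (leq_trans (max_card _)) ?orbT //.
exact: leq_card_pebbling_number rB conB.
Qed.

Lemma sum_Posz_slice_deficit T c :
  (\sum_(j in T) (Posz piA - Posz (slice_extra c j)))%R =
    Posz (\sum_(j in T) slice_deficit c j).
Proof.
rewrite Posz_sum; apply: eq_bigr => j _.
by rewrite subzn // ltnW // slice_extra_lt.
Qed.

End Connected.

Lemma card_sub_sum_x_ind S c :
  (Posz #|S| - \sum_(i in S) Posz (x_ind c i 1))%R =
    Posz #|[set i in S | slice_sat c i == 0]|.
Proof.
rewrite -!sum1_card !Posz_sum -sumrB.
rewrite [RHS](eq_bigl (fun i => (i \in S) && (slice_sat c i == 0))); last first.
  by move=> i; rewrite inE.
rewrite [RHS]big_mkcondr; apply: eq_bigr => i _.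
by rewrite /x_ind; case: (slice_sat c i).
Qed.

Lemma sub1_y_ind c (n k : nat) :
  (1 - Posz (y_ind K c (Posz n - Posz k)))%R =
    Posz (\sum_(b : B) slice_set c b + k < n).
Proof. by rewrite /y_ind; case: ifP; case: ltnP; lia. Qed.

Lemma mul2_pebbling_number_sides :
  (2 * Posz (pebbling_number G) * Posz (pebbling_number H))%R =
    Posz (2 * (piA * piB)).
Proof. by case: K => /=; lia. Qed.

End Slices.

Lemma leq_bigM (M P D m n : nat) :
    P < M -> (m = 0 -> n = 0 -> P < D) ->
  (Posz P + 1 <= Posz D + Posz M * Posz m + Posz M * Posz n)%R.
Proof. by case: m n => [|m] [|n] PM PD; have := PD; nia. Qed.

Theorem theorem3 (G H : sgraph) (rG : G) (rH : H) (K : side)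
    (S T : {set graphKbar G H K}) (c : config (cprod G H)) :
  graph_connected G -> graph_connected H ->
  [disjoint S & T] ->
  (forall i j, i \in S -> j \in T -> adj i j) ->
  ~ @pebble_solvable (cprod G H) c (rG, rH) ->
  let piK : int := Posz (pebbling_number (graphK G H K)) in
  let piK' : int := Posz (pebbling_number (graphKbar G H K)) in
  let M : int := (2 * Posz (pebbling_number G) * Posz (pebbling_number H))%R in
  ((\sum_(i in S) Posz (slice_pair c i)) + 1 <=
     (\sum_(j in T) (piK - Posz (slice_extra c j)))
     + M * (Posz #|S| - \sum_(i in S) Posz (x_ind c i 1))
     + M * (1 - Posz (y_ind K c (piK' - Posz #|T|))))%R.
Proof.
move=> conG conH disST adjST unsol; lazy zeta.
have conK : graph_connected (graphK G H K) by case: (K).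
have conKbar : graph_connected (graphKbar G H K) by case: (K).
have [rK [rKbar rE]] := slice_vertexP K ((rG, rH) : cprod G H).
rewrite rE in unsol.
rewrite (mul2_pebbling_number_sides G H K) (sum_Posz_slice_deficit conK rK).
rewrite card_sub_sum_x_ind sub1_y_ind -Posz_sum.
apply: leq_bigM => [|/cards0_eq all_sat]; first exact: sum_slice_pair_lt.
case: ltnP => // sets _.
apply: (unsolvable_sum_slice_pair_lt conK conKbar disST adjST unsol) => // i iS.
by rewrite lt0n; apply: contraFN (in_set0 i) => sat0; rewrite -all_sat inE iS.
Qed.
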